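(* Let $p:\mathring\Sigma_1\to\mathring\Sigma_0$ be a covering projection between perforated surfaces, where $\Sigma_0$ and $\Sigma_1$ are connected surfaces. Then there exist a covering projection $p':\Sigma_1'\to\Sigma_0'$ of surfaces and embeddings $i_k:\mathring\Sigma_k\to\Sigma_k'$, $k=0,1$, such that (i) $\Sigma_k'\setminus i_k(\mathring\Sigma_k)$ is a countable dense subset of $\Sigma_k'$ for $k=0,1$, and (ii) $p'\circ i_1=i_0\circ p$.
   Context: A surface is a paracompact 2-manifold without boundary. For a connected surface $\Sigma$, $\mathring\Sigma=\Sigma\setminus A$ where $A$ is a countable dense subset of $\Sigma$ (the homeomorphism type does not depend on $A$); such a space is called a perforated surface. *)

(* Defs.v *)
From HB Require Import structures.
From mathcomp Require Import all_boot all_order all_algebra.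
From mathcomp Require Import all_classical all_reals all_analysis.

Set Implicit Arguments.
Unset Strict Implicit.
Unset Printing Implicit Defensive.

Import numFieldNormedType.Exports.
Local Open Scope classical_set_scope.

(* Throughout, a set [A] used as a type is [set_type A], which the library
   equips with the topology induced by the inclusion. *)

Definition homeomorphism (X Y : topologicalType) (f : X -> Y) : Prop :=
  exists g : Y -> X,
    [/\ continuous f, continuous g, cancel f g & cancel g f].

Definition embedding (X Y : topologicalType) (f : X -> Y) : Prop :=
  exists2 h : X -> range f,
    homeomorphism h & forall x : X, set_val (h x) = f x.

Definition maps_homeomorphically (X Y : topologicalType) (f : X -> Y)
    (V : set X) (U : set Y) : Prop :=
  exists2 h : V -> U,
    homeomorphism h & forall x : V, set_val (h x) = f (set_val x).

Definition evenly_covered (X Y : topologicalType) (p : X -> Y)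
    (U : set Y) : Prop :=
  exists F : set (set X),
    [/\ F `<=` open,
        trivIset F id,
        p @^-1` U = \bigcup_(V in F) V &
        forall V, F V -> maps_homeomorphically p V U].

(* Surjectivity is part of the definition; it only excludes points with an
   empty fibre. *)
Definition covering_projection (X Y : topologicalType) (p : X -> Y) : Prop :=
  [/\ continuous p,
      range p = [set: Y] &
      forall y : Y, exists2 U : set Y, open_nbhs y U & evenly_covered p U].

Definition locally_finite (T : topologicalType) (G : set (set T)) : Prop :=
  forall x : T, exists2 N : set T,
    nbhs x N & finite_set [set B | G B /\ B `&` N !=set0].

Definition paracompact (T : topologicalType) : Prop :=
  forall F : set (set T),
    F `<=` open -> \bigcup_(A in F) A = [set: T] ->
    exists G : set (set T),
      [/\ G `<=` open,
          \bigcup_(B in G) B = [set: T],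
          (forall B, G B -> exists2 A, F A & B `<=` A) &
          locally_finite G].

Definition locally_euclidean (R : realType) (n : nat) (T : topologicalType)
    : Prop :=
  forall x : T, exists2 U : set T, open_nbhs x U &
    exists2 phi : U -> 'rV[R]_n, embedding phi & open (range phi).

Definition surface (R : realType) (T : topologicalType) : Prop :=
  [/\ hausdorff_space T, paracompact T & locally_euclidean R 2 T].

Definition connected_surface (R : realType) (T : topologicalType) : Prop :=
  surface R T /\ connected [set: T].

Definition countable_dense (T : topologicalType) (A : set T) : Prop :=
  countable A /\ dense A.

(* [perforated A] is the space Sigma \ A; it is a perforated surface when
   Sigma is a connected surface and A is countable and dense. *)
Definition perforated (Sigma : topologicalType) (A : set Sigma)
  : topologicalType := set_type (~` A).

(* Main.v *)
(* Removing countably many points from a small disc [U] leaves it connected, so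
   two trivialisations of [p] over [U \ A0] have the same sheets.  Let [W] be
   the union of the open [U] in [Sigma0] such that [U \ A0] is evenly covered; it
   contains the complement of [A0].  Each sheet over [U \ A0] is completed to a copy of [U],
   and by uniqueness these copies glue to a covering of [W].  The glued space is
   realised as the set of pairs [(w, G)] where [w] is in [W] and [G] is the
   filter on the total space generated by the traces of a sheet on the
   neighbourhoods of [w]; over a point outside [A0], [G] is the neighbourhood
   filter of a point of the fibre.
   A separable paracompact space is Lindelof, hence [Sigma0] is second
   countable; the countable dense set [A1] forces every family of disjoint
   sheets to be countable, so the glued space is second countable as well, and
   a regular Lindelof space is paracompact. *)
Require Import Defs.
From HB Require Import structures.
From mathcomp Require Import all_boot all_order all_algebra.
From mathcomp Require Import all_classical all_reals all_analysis.
From mathcomp Require Import ring lra.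

Import Order.TTheory GRing.Theory Num.Theory.
Import numFieldNormedType.Exports.

Set Implicit Arguments.
Unset Strict Implicit.
Unset Printing Implicit Defensive.

Local Open Scope classical_set_scope.

(** * Partial homeomorphisms and charts *)

Lemma set_type_inj (T : Type) (A : set T) : injective (@set_val T A).
Proof. by move=> x y; rewrite set_valE => /val_inj. Qed.

Lemma open_set_typeP (T : topologicalType) (A : set T) (O : set A) :
  open O <-> exists2 O' : set T, open O' & O = set_val @^-1` O'.
Proof. by split=> -[ O' oO' e]; exists O'. Qed.

Lemma open_set_val_preimage (T : topologicalType) (A O : set T) :
  open O -> open ((set_val : A -> T) @^-1` O).
Proof. by move=> oO; apply/open_set_typeP; exists O. Qed.

Lemma set_val_continuous (T : topologicalType) (A : set T) :
  continuous (set_val : A -> T).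
Proof. by apply/continuousP => O; exact: open_set_val_preimage. Qed.

Lemma continuous_into_set_type (X Y : topologicalType) (A : set Y)
    (f : X -> A) :
  continuous (set_val \o f) -> continuous f.
Proof.
move=> /continuousP cf; apply/continuousP => O /open_set_typeP[ O' oO' ->].
exact: cf.
Qed.

(** The condition on open sets says that [X] carries the topology induced by [f], which makes the
    inverse on the range continuous. *)
Lemma embedding_of_preimages (X Y : topologicalType) (f : X -> Y) :
  continuous f -> injective f ->
  (forall O : set X, open O -> exists2 O' : set Y, open O' & O = f @^-1` O') ->
  embedding f.
Proof.
move=> cf injf fO.
have fR x : f x \in range f by apply/mem_set; exists x.
pose h x : range f := SigSub (fR x).
have hE x : set_val (h x) = f x by [].
have [g gE] : {g : range f -> X & forall z, f (g z) = set_val z}.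
  apply: (@choice _ _ (fun z x => f x = set_val z)) => z.
  by have [x _ e] := set_valP z; exists x; rewrite e.
exists h => //; exists g; split.
- exact: continuous_into_set_type.
- apply/continuousP => O /fO[ O' oO' ->]; apply/open_set_typeP; exists O' => //.
  by apply/seteqP; split=> z /=; rewrite gE.
- by move=> x; apply: injf; rewrite gE.
- by move=> z; apply: set_type_inj; rewrite hE gE.
Qed.

Lemma embedding_continuous (X Y : topologicalType) (f : X -> Y) :
  embedding f -> continuous f.
Proof.
move=> [h [g [ch _ _ _]] hE].
have -> : f = set_val \o h by apply/funext => x /=; rewrite hE.
by move=> x; apply: continuous_comp; [exact: ch|exact: set_val_continuous].
Qed.

Lemma continuous_extend_open (X Z : topologicalType) (U : set X) (k : U -> Z)
    (f : X -> Z) :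
  open U -> continuous k -> (forall u, f (set_val u) = k u) ->
  {in U, continuous f}.
Proof.
move=> oU /continuousP ck fk y /[!inE] Uy B.
rewrite nbhsE /= => -[ O [oO Ofy] OB].
have /open_set_typeP[ O' oO' kO] := ck O oO.
pose u : U := SigSub (mem_set Uy).
apply: (@filterS _ _ _ (U `&` O')).
  move=> z [Uz O'z] /=; apply: OB.
  pose v : U := SigSub (mem_set Uz).
  have : (k @^-1` O) v by rewrite kO.
  by rewrite /= -fk.
apply: open_nbhs_nbhs; split; first exact: openI.
split=> //; suff : (set_val @^-1` O') u by [].
by rewrite -kO /= -fk.
Qed.

(** Total functions with arbitrary values outside [U] and [D] take the place of maps between
    subtypes, so that charts compose and restrict without coercions. As [U] and [D] are open,
    continuity at their points may be taken in the ambient spaces. *)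
Definition partial_homeo (X Y : topologicalType) (U : set X) (D : set Y)
    (f : X -> Y) (g : Y -> X) : Prop :=
  [/\ open U, open D,
    (forall x, U x -> [/\ D (f x), g (f x) = x & {for x, continuous f}]) &
    (forall y, D y -> [/\ U (g y), f (g y) = y & {for y, continuous g}])].

Lemma open_preimage_in (X Y : topologicalType) (U : set X) (O : set Y)
    (f : X -> Y) :
  open U -> open O -> (forall x, U x -> {for x, continuous f}) ->
  open (U `&` f @^-1` O).
Proof.
move=> oU oO cf; rewrite openE => x [Ux Ofx].
apply: filterI; first exact: open_nbhs_nbhs.
by apply: (cf x Ux); exact: open_nbhs_nbhs.
Qed.

Section partial_homeo_theory.
Variables (X Y Z : topologicalType).

Lemma partial_homeo_sym (U : set X) (D : set Y) f g :
  partial_homeo U D f g -> partial_homeo D U g f.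
Proof. by case. Qed.

Lemma partial_homeo_comp (U : set X) (D : set Y) f g
    (U' : set Y) (D' : set Z) f' g' :
  partial_homeo U D f g -> partial_homeo U' D' f' g' ->
  partial_homeo (U `&` f @^-1` U') (D' `&` g' @^-1` D) (f' \o f) (g \o g').
Proof.
move=> [oU oD fP gP] [oU' oD' fP' gP']; split.
- by apply: open_preimage_in => // x /fP[].
- by apply: open_preimage_in => // x /gP'[].
- move=> x [/fP[Dfx gfx cf] /fP'[D'fx gfx' cf']]; split => /=.
  + by split=> //=; rewrite gfx'.
  + by rewrite gfx'.
  + exact: continuous_comp.
- move=> x [/gP'[Dfx gfx cf] /gP[D'fx gfx' cf']]; split => /=.
  + by split=> //=; rewrite gfx'.
  + by rewrite gfx'.
  + exact: continuous_comp.
Qed.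

Lemma partial_homeo_image (U : set X) (D : set Y) f g (O : set X) :
  partial_homeo U D f g -> O `<=` U -> f @` O = D `&` g @^-1` O.
Proof.
move=> [_ _ fP gP] OU; apply/seteqP; split=> [_ [x Ox <-]|y [/gP[? e _] ?]].
  by have [? e _] := fP _ (OU _ Ox); split=> //=; rewrite e.
by exists (g y).
Qed.

Lemma partial_homeo_image_open (U : set X) (D : set Y) f g (O : set X) :
  partial_homeo U D f g -> open O -> O `<=` U -> open (f @` O).
Proof.
move=> h oO OU; rewrite (partial_homeo_image h OU).
by case: h => [oU oD fP gP]; apply: open_preimage_in => // y /gP[].
Qed.

Lemma partial_homeo_maps (U : set X) (D : set Y) f g :
  partial_homeo U D f g -> maps_homeomorphically f U D.
Proof.
move=> [oU oD fP gP].
have fD (u : U) : f (set_val u) \in D.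
  by apply/mem_set; have [] := fP _ (set_valP u).
have gU (u : D) : g (set_val u) \in U.
  by apply/mem_set; have [] := gP _ (set_valP u).
pose h u : D := SigSub (fD u).
pose k u : U := SigSub (gU u).
have hE u : set_val (h u) = f (set_val u) by [].
have kE u : set_val (k u) = g (set_val u) by [].
exists h => //; exists k; split.
- apply: continuous_into_set_type; change (continuous (f \o set_val : U -> Y)).
  by move=> u; apply: continuous_comp; [exact: set_val_continuous|
    have [] := fP _ (set_valP u)].
- apply: continuous_into_set_type; change (continuous (g \o set_val : D -> X)).
  by move=> u; apply: continuous_comp; [exact: set_val_continuous|
    have [] := gP _ (set_valP u)].
- move=> u; apply: set_type_inj; rewrite kE hE.
  by have [] := fP _ (set_valP u).
- move=> u; apply: set_type_inj; rewrite hE kE.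
  by have [] := gP _ (set_valP u).
Qed.

End partial_homeo_theory.

(** * Charts as partial homeomorphisms *)

Section charts.
Variables (R : realType) (n : nat).

Definition chart_at (T : topologicalType) (x : T) : Prop :=
  exists (U : set T) (D : set 'rV[R]_n) f g,
    partial_homeo U D f g /\ U x.

Lemma locally_euclidean_chart (T : topologicalType) :
  locally_euclidean R n T <-> forall x : T, chart_at x.
Proof.
split=> [eT x|cT x]; last first.
  have [U [D [f [g [[oU oD fP gP] Ux]]]]] := cT x.
  exists U => //; exists (f \o set_val).
    apply: embedding_of_preimages.
    - move=> u; apply: continuous_comp; first exact: set_val_continuous.
      by have [] := fP _ (set_valP u).
    - move=> u v /(congr1 g) /=.
      have [_ -> _] := fP _ (set_valP u).
      have [_ -> _] := fP _ (set_valP v).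
      exact: set_type_inj.
    - move=> O /open_set_typeP[ O' oO' ->]; exists (D `&` g @^-1` O').
        by apply: open_preimage_in => // y /gP[].
      apply/seteqP; split=> u /=; have [Du e _] := fP _ (set_valP u).
        by rewrite e.
      by rewrite e => -[].
  suff -> : range (f \o (set_val : U -> T)) = D by [].
  apply/seteqP; split=> [_ [u _ <-]|y /gP[Uy e _]].
    by have [] := fP _ (set_valP u).
  by exists (SigSub (mem_set Uy)).
have [U [oU Ux] [phi ephi oR]] := eT x.
have [h [k [ch ck hk kh]] hE] := ephi.
have cphi := embedding_continuous ephi.
(* Off [U] and off the range of [phi], the values of [f] and [g] are defaults: [phi] at [x], and
   [x]. *)
pose f y := if pselect (U y) is left Uy then phi (SigSub (mem_set Uy)) else
  phi (SigSub (mem_set Ux)).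
have fE (u : U) : f (set_val u) = phi u.
  rewrite /f; case: pselect => [Uu|/(_ (set_valP u))//].
  by congr phi; apply: set_type_inj.
pose g z := if pselect (range phi z) is left Rz then
  set_val (k (SigSub (mem_set Rz))) else x.
have gE (z : range phi) : g (set_val z) = set_val (k z).
  rewrite /g; case: pselect => [Rz|/(_ (set_valP z))//].
  by congr (set_val (k _)); apply: set_type_inj.
have UE y (Uy : U y) : y = set_val (SigSub (mem_set Uy) : U) by [].
have RE z (Rz : range phi z) : z = set_val (SigSub (mem_set Rz) : range phi).
  by [].
exists U, (range phi), f, g; split=> //; split=> // [y Uy|z Rz].
  split.
  - by rewrite (UE y Uy) fE; exists (SigSub (mem_set Uy)).
  - by rewrite (UE y Uy) fE -hE gE hk.
  - apply: (continuous_extend_open oU cphi fE); exact/mem_set.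
split.
- by rewrite (RE z Rz) gE; exact: set_valP.
- by rewrite (RE z Rz) gE fE -hE kh.
- have ck' : continuous (set_val \o k).
    by move=> u; apply: continuous_comp; [exact: ck|exact: set_val_continuous].
  apply: (continuous_extend_open oR ck' gE); exact/mem_set.
Qed.

(** Charts of [Y] pull back along the partial homeomorphisms. This makes both new spaces locally
    Euclidean, since each is locally like [Sigma0]. *)
Lemma locally_euclidean_local (X Y : topologicalType) :
  (forall x : X, exists (U : set X) (D : set Y) f g,
    partial_homeo U D f g /\ U x) ->
  locally_euclidean R n Y -> locally_euclidean R n X.
Proof.
move=> XY /locally_euclidean_chart cY; apply/locally_euclidean_chart => x.
have [U [D [f [g [h Ux]]]]] := XY x.
have [U' [D' [f' [g' [h' U'fx]]]]] := cY (f x).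
exists (U `&` f @^-1` U'), (D' `&` g' @^-1` D), (f' \o f), (g \o g').
by split; [exact: partial_homeo_comp|split].
Qed.

End charts.

(** * Countability and paracompactness *)

Lemma countable_image (T U : Type) (f : T -> U) (A : set T) :
  countable A -> countable (f @` A).
Proof. exact/sub_countable/card_image_le. Qed.

Lemma countable_preimage_inj (T U : Type) (f : T -> U) (A : set U) :
  injective f -> countable A -> countable (f @^-1` A).
Proof.
move=> finj /countable_injP[g ginj]; apply/countable_injP.
exists (g \o f) => x y /[!inE] Ax Ay /ginj fxy.
by apply/finj/fxy; rewrite inE.
Qed.

Lemma countable_subsingleton (T : Type) (A : set T) :
  (forall x y, A x -> A y -> x = y) -> countable A.
Proof.
move=> Asub; apply/countable_injP; exists (fun=> 0%N) => x y /[!inE] Ax Ay _.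
exact: Asub.
Qed.

(** * Lindelof spaces, bases and paracompactness *)

Definition lindelof (T : topologicalType) : Prop :=
  forall F : set (set T),
    F `<=` open -> \bigcup_(A in F) A = [set: T] ->
    exists G, [/\ G `<=` F, countable G & \bigcup_(A in G) A = [set: T]].

Lemma countable_refinement_subcover (T : topologicalType) (F G : set (set T)) :
  countable G -> \bigcup_(B in G) B = [set: T] ->
  (forall B, G B -> exists2 A, F A & B `<=` A) ->
  exists H, [/\ H `<=` F, countable H & \bigcup_(A in H) A = [set: T]].
Proof.
move=> cG Gcov GF.
have [phi phiP] : {phi : set T -> set T &
    forall B, G B -> F (phi B) /\ B `<=` phi B}.
  apply: (@choice _ _ (fun B A => G B -> F A /\ B `<=` A)) => B.
  have [/GF[A FA BA]|nGB] := pselect (G B); first by exists A.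
  by exists set0 => /nGB.
exists (phi @` G); split.
- by move=> _ [B GB <-]; have [] := phiP B GB.
- exact: countable_image.
- apply/seteqP; split=> // x _.
  have [B GB Bx] : (\bigcup_(B in G) B) x by rewrite Gcov.
  by exists (phi B); [exists B|have [_] := phiP B GB; apply].
Qed.

(** Each nonempty open member contains a point of [A], and each point of [A] lies in only finitely
    many members. *)
Lemma locally_finite_countable (T : topologicalType) (A : set T)
    (G : set (set T)) :
  countable_dense A -> G `<=` open -> locally_finite G ->
  countable [set B | G B /\ B !=set0].
Proof.
move=> [cA dA] oG lG.
suff : countable (\bigcup_(a in A) [set B | G B /\ B a]).
  apply: sub_countable; apply: subset_card_le => B [GB B0].
  have [a [Ba Aa]] := dA B B0 (oG _ GB).
  by exists a.
apply: bigcup_countable => // a _; apply: finite_set_countable.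
have [N Na fN] := lG a; apply: sub_finite_set fN => B [GB Ba]; split=> //.
by exists a; split=> //; exact: nbhs_singleton.
Qed.

Lemma paracompact_separable_lindelof (T : topologicalType) (A : set T) :
  paracompact T -> countable_dense A -> lindelof T.
Proof.
move=> pT dA F oF Fcov; have [G [ oG Gcov GF lG]] := pT F oF Fcov.
apply: (@countable_refinement_subcover _ _ [set B | G B /\ B !=set0]).
- exact: locally_finite_countable dA oG lG.
- apply/seteqP; split=> // x _.
  have [B GB Bx] : (\bigcup_(B in G) B) x by rewrite Gcov.
  by exists B => //; split=> //; exists x.
- by move=> B [GB _]; exact: GF.
Qed.

Lemma basisP (T : topologicalType) (B : set (set T)) :
  B `<=` open ->
  (forall x O, open O -> O x -> exists b, [/\ B b, b x & b `<=` O]) ->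
  basis B.
Proof.
move=> oB BP; split=> // x V; rewrite nbhsE /= => -[ O [ oO Ox] OV].
have [b [Bb bx bO]] := BP x O oO Ox.
by exists b => //; exact: subset_trans OV.
Qed.

Lemma basis_sub (T : topologicalType) (B : set (set T)) x (O : set T) :
  basis B -> open O -> O x -> exists b, [/\ B b, b x & b `<=` O].
Proof.
move=> [_ /(_ x O) h] oO Ox; have [|b [Bb bx] bO] := h; last by exists b.
exact: open_nbhs_nbhs.
Qed.

Lemma second_countable_lindelof (T : topologicalType) :
  @second_countable T -> lindelof T.
Proof.
move=> [B cB bB] F oF Fcov.
apply: (@countable_refinement_subcover _ _
  [set b | B b /\ exists2 A, F A & b `<=` A]) => [||b []//].
  by apply: sub_countable cB; apply: subset_card_le => b [].
apply/seteqP; split=> // x _.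
have [A FA Ax] : (\bigcup_(B in F) B) x by rewrite Fcov.
have [b [Bb bx bA]] := basis_sub bB (oF _ FA) Ax.
by exists b => //; split=> //; exists A.
Qed.

(** Countably many of the given neighbourhoods cover [T]; the union of their countable local bases
    is a basis. *)
Lemma lindelof_second_countable (T : topologicalType) :
  lindelof T ->
  (forall x : T, exists U : set T, exists B : set (set T),
    [/\ open U, U x, countable B, B `<=` open &
    forall y O, U y -> open O -> O y -> exists b, [/\ B b, b y & b `<=` O]]) ->
  @second_countable T.
Proof.
move=> lT locB.
pose good (U : set T) (B : set (set T)) := [/\ open U, countable B, B `<=` open
  & forall y O, U y -> open O -> O y -> exists b, [/\ B b, b y & b `<=` O]].
have [|| G [GF cG Gcov]] := lT [set U | exists B, good U B].
- by move=> U [B []].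
- apply/seteqP; split=> // x _; have [U [B [? ? ? ? ?]]] := locB x.
  by exists U => //; exists B.
have [BU BUP] : {BU : set T -> set (set T) & forall U, G U -> good U (BU U)}.
  apply: (@choice _ _ (fun U B => G U -> good U B)) => U.
  have [/GF[B UB]|nGU] := pselect (G U); first by exists B.
  by exists set0 => /nGU.
exists (\bigcup_(U in G) BU U).
  by apply: bigcup_countable => // U /BUP[].
apply: basisP => [b [U /BUP[_ _ oB _]]|x O oO Ox]; first exact: oB.
have [U GU Ux] : (\bigcup_(B in G) B) x by rewrite Gcov.
have [_ _ _ /(_ x O Ux oO Ox)[b [? ? ?]]] := BUP U GU.
by exists b; split=> //; exists U.
Qed.

Lemma second_countable_set_type (T : topologicalType) (A : set T) :
  @second_countable T -> @second_countable A.
Proof.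
move=> [B cB bB]; exists ((fun b => set_val @^-1` b) @` B).
  exact: countable_image.
apply: basisP => [_ [b Bb <-]|x O /open_set_typeP[ O' oO' ->] O'x].
  by apply: open_set_val_preimage; apply: (proj1 bB).
have [b [Bb bx bO]] := basis_sub bB oO' O'x.
by exists (set_val @^-1` b); split=> //; [exists b|move=> y /bO].
Qed.

Lemma regular_nbhs (T : topologicalType) (x : T) (O : set T) :
  regular_space T -> open O -> O x ->
  exists2 B, open_nbhs x B & closure B `<=` O.
Proof.
move=> rT oO Ox; have [|V Vx VO] := rT x O; first exact: open_nbhs_nbhs.
move: Vx; rewrite nbhsE => -[B Bx BV]; exists B => //.
by apply: subset_trans VO; exact: closureS.
Qed.

(** Regularity and the Lindelof property give a countable cover [G] whose closures lie in members of
    [F]. After enumerating [G], the closures of all earlier sets are cut out of each chosen member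
    of [F]. *)
Lemma regular_lindelof_paracompact (T : topologicalType) :
  regular_space T -> lindelof T -> paracompact T.
Proof.
move=> rT lT F oF Fcov.
have [|| G [GK cG Gcov]] :=
    lT [set B | open B /\ exists2 A, F A & closure B `<=` A].
- by move=> B [].
- apply/seteqP; split=> // x _.
  have [A FA Ax] : (\bigcup_(B in F) B) x by rewrite Fcov.
  have [B [ oB Bx] BA] := regular_nbhs rT (oF _ FA) Ax.
  by exists B => //; split=> //; exists A.
have [phi phiP] : {phi : set T -> set T &
    forall B, G B -> F (phi B) /\ closure B `<=` phi B}.
  apply: (@choice _ _ (fun B A => G B -> F A /\ closure B `<=` A)) => B.
  have [/GK[_ [A FA BA]]|nGB] := pselect (G B); first by exists A.
  by exists set0 => /nGB.
have [f finj] : exists f : set T -> nat, {in G &, injective f}.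
  by apply/countable_injP.
have fin n : finite_set [set B | G B /\ (f B < n)%N].
  have -> : [set B | G B /\ (f B < n)%N] = (G `&` f @^-1` `I_n) by [].
  (* [f] is injective on [G] only, so sets outside [G] are sent to [n], which is not in the initial
     segment. *)
  pose f' B := if pselect (G B) then f B else n.
  have f'P B : (f' B < n)%N -> G B /\ f' B = f B.
    by rewrite /f'; case: (pselect (G B)) => GB /=; rewrite ?ltnn.
  have -> : G `&` f @^-1` `I_n = f' @^-1` `I_n.
    apply/seteqP; split=> [B [GB /= fB]|B /= f'B].
      by rewrite /f'; case: pselect.
    by have [GB f'BE] := f'P B f'B; split=> //=; rewrite -f'BE.
  apply: finite_preimage; last exact: finite_II.
  move=> B C /[!inE] /= /f'P[GB ->] /f'P[GC ->].
  by apply: finj; rewrite inE.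
pose E B := phi B `\` \bigcup_(C in [set C | G C /\ (f C < f B)%N]) closure C.
exists (E @` G); split.
- move=> _ [B GB <-]; have [FB _] := phiP B GB.
  rewrite /E setDE; apply: openI; first exact: oF.
  by apply: closed_openC; apply: closed_bigcup => // C _; exact: closed_closure.
- apply/seteqP; split=> // x _.
  have [B GB Bx] : (\bigcup_(B in G) B) x by rewrite Gcov.
  (* The least index whose [phi C] contains [x] works: an earlier closure containing [x] would lie
     in an earlier [phi C']. *)
  have ex : exists n, `[< exists B, [/\ G B, phi B x & f B = n] >].
    exists (f B); apply/asboolP; exists B; split=> //.
    by have [_] := phiP B GB; apply; exact: subset_closure.
  case: (ex_minnP ex) => n /asboolP[C [GC Cx fC]] nmin.
  exists (E C); first by exists C.
  split=> // -[C' [GC' lt] C'x].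
  suff : (n <= f C')%N by rewrite -fC leqNgt lt.
  apply: nmin; apply/asboolP; exists C'; split=> //.
  by have [_] := phiP C' GC'; apply.
- move=> _ [B GB <-]; have [FB _] := phiP B GB; exists (phi B) => //.
  exact: subDsetl.
- move=> x.
  have [B GB Bx] : (\bigcup_(B in G) B) x by rewrite Gcov.
  have [ oB _] := GK B GB.
  (* The neighbourhood [B] of [x] is removed from every [E C] of larger index, so it meets only
     those with index at most [f B]. *)
  exists B; first exact: open_nbhs_nbhs.
  apply: sub_finite_set (finite_image E (fin (f B).+1)).
  move=> _ [[C GC <-] [y [[_ nCy] By]]].
  exists C => //; split=> //; rewrite ltnS leqNgt; apply/negP => lt.
  by apply: nCy; exists B => //; exact: subset_closure.
Qed.

(** * Locally Euclidean spaces *)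

Local Open Scope ring_scope.

Section euclidean_space.
Variables (R : realType) (n : nat).
Implicit Types (c v : 'rV[R]_n) (e : R).

(** For positive [e] this is the open ball of the maximum norm, written coordinatewise. *)
Definition rV_box c e : set 'rV[R]_n :=
  [set v | forall j, `|c 0 j - v 0 j| < e].

Lemma rV_box_center c e : 0 < e -> rV_box c e c.
Proof. by move=> e0 j; rewrite subrr normr0. Qed.

Lemma nbhs_sub_rV_box c (V : set 'rV[R]_n) :
  nbhs c V -> exists2 e, 0 < e & rV_box c e `<=` V.
Proof.
move=> /nbhs_ballP[e /= e0 eV]; exists e => // v cv; apply: eV; split=> //.
by move=> i j; rewrite (ord1 i); exact: cv.
Qed.

Lemma nbhs_rV_box c e : 0 < e -> nbhs c (rV_box c e).
Proof.
move=> e0; apply/nbhs_ballP; exists e => //= v [_ cv] j.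
exact: cv.
Qed.

Lemma open_rV_box c e : open (rV_box c e).
Proof.
rewrite openE => v cv.
have [d d0 dP] : exists2 d, 0 < d & forall j, `|c 0 j - v 0 j| + d <= e.
  (* The least slack over all coordinates; the initial value 1 keeps it positive even when [n] is
     0. *)
  exists (\big[Num.min/1]_j (e - `|c 0 j - v 0 j|)).
    by elim/big_ind: _ => // [x y x0 y0|j _]; rewrite ?lt_min ?x0 ?subr_gt0.
  move=> j; rewrite addrC -lerBrDr; exact: bigmin_le.
apply: filterS (nbhs_rV_box v d0) => u vu j.
rewrite (le_lt_trans (ler_distD (v 0 j) _ _))//.
by apply: lt_le_trans (dP j); rewrite ltrD2l.
Qed.

Lemma rV_second_countable : @second_countable 'rV[R]_n.
Proof.
pose B (q : 'rV[rat]_n * rat) := rV_box (map_mx ratr q.1) (ratr q.2).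
exists (range B); first exact/countable_image/countableP.
apply: basisP => [_ [q _ <-]|x O oO Ox]; first exact: open_rV_box.
have [e e0 eO] := nbhs_sub_rV_box (open_nbhs_nbhs (conj oO Ox)).
(* With a rational radius below [e / 2] and a rational centre within that radius of [x], the box
   contains [x] and stays inside the box of radius [e] about [x]. *)
have [r] := rat_in_itvoo (divr_gt0 e0 (ltr0n R 2)).
rewrite in_itv /= => /andP[r0 re].
have [q qP] : {q : 'I_n -> rat & forall j, `|ratr (q j) - x 0 j| < ratr r}.
  apply: (@choice _ _ (fun j t => `|ratr t - x 0 j| < ratr r)) => j.
  have [|t] := @rat_in_itvoo R (x 0 j) (x 0 j + ratr r); first by rewrite ltrDl.
  rewrite in_itv /= => /andP[xt tx]; exists t.
  by rewrite ger0_norm ?subr_ge0 ?ltW// ltrBlDl.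
exists (B (\row_j q j, r)); split=> [|j|v qv]; first by exists (\row_j q j, r).
  by rewrite !mxE; exact: qP.
apply: eO => j; rewrite (le_lt_trans (ler_distD (ratr (q j)) _ _))//.
rewrite (splitr e) ltrD//; first by rewrite distrC (lt_trans (qP j)).
by have := qv j; rewrite !mxE => /lt_trans; apply.
Qed.

Lemma rV_locally_compact c (O : set 'rV[R]_n) :
  open O -> O c -> exists K, [/\ compact K, nbhs c K & K `<=` O].
Proof.
move=> oO Oc; have [e e0 eO] := nbhs_sub_rV_box (open_nbhs_nbhs (conj oO Oc)).
exists [set v : 'rV[R]_n |
  forall j, `[c 0 j - e / 2, c 0 j + e / 2]%classic (v 0 j)].
split.
- apply: (@rV_compact R n (fun j => `[c 0 j - e / 2, c 0 j + e / 2]%classic)).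
  by move=> j; exact: segment_compact.
- apply: filterS (nbhs_rV_box c (divr_gt0 e0 (ltr0n R 2))) => v cv j /=.
  by rewrite in_itv /= -ler_distlC ltW.
- move=> v cv; apply: eO => j; have := cv j.
  rewrite /= in_itv /= -ler_distlC => /le_lt_trans; apply.
  by rewrite ltr_pdivrMr// ltr_pMr// ltr1n.
Qed.

Variable T : topologicalType.
Hypothesis eT : locally_euclidean R n T.

Lemma locally_euclidean_second_countable :
  lindelof T -> @second_countable T.
Proof.
move=> lT; apply: lindelof_second_countable => // x.
have /locally_euclidean_chart/(_ x)[U [D [f [g [h Ux]]]]] := eT.
have [ oU oD fP gP] := h.
have [B cB bB] := rV_second_countable.
exists U, ((fun b => U `&` f @^-1` b) @` B); split=> //.
- exact: countable_image.
- move=> _ [b Bb <-]; apply: open_preimage_in => //; first exact: (proj1 bB).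
  by move=> y /fP[].
- move=> y O Uy oO Oy; have [Dfy gfy _] := fP y Uy.
  have oDO : open (D `&` g @^-1` O).
    by apply: open_preimage_in => // z /gP[].
  have [|b [Bb bfy bDO]] := basis_sub (x := f y) bB oDO.
    by split=> //=; rewrite gfy.
  exists (U `&` f @^-1` b); split=> //; first by exists b.
  by move=> z [Uz /bDO[_ /=]]; have [_ -> _] := fP z Uz.
Qed.

(** A chart carries a compact neighbourhood back to [T], and a Hausdorff space is regular at a point
    with a compact neighbourhood. *)
Lemma locally_euclidean_regular : hausdorff_space T -> regular_space T.
Proof.
move=> hT x.
have /locally_euclidean_chart/(_ x)[U [D [f [g [h Ux]]]]] := eT.
have [ oU oD fP gP] := h.
have [Dfx gfx cfx] := fP x Ux.
have [K [cK Kfx KD]] := rV_locally_compact oD Dfx.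
apply: (@compact_regular _ x (g @` K)) => //.
  apply: continuous_compact => //; apply: continuous_in_subspaceT => y /[!inE].
  by move=> /KD/gP[].
apply: (@filterS _ _ _ (U `&` f @^-1` K)).
  by move=> z [Uz Kfz]; have [_ gfz _] := fP z Uz; exists (f z).
by apply: filterI; [exact: open_nbhs_nbhs|exact: cfx].
Qed.

End euclidean_space.

Lemma second_countable_surface (R : realType) (T : topologicalType) :
  hausdorff_space T -> @second_countable T -> locally_euclidean R 2 T ->
  surface R T.
Proof.
move=> hT cT eT; split=> //; apply: regular_lindelof_paracompact.
  exact: locally_euclidean_regular eT hT.
exact: second_countable_lindelof.
Qed.

(** A countable set has Lebesgue measure zero, whereas the interval has measure [b - a]. *)
Lemma interval_avoid_countable (R : realType) (a b : R) (C : set R) :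
  a < b -> countable C -> exists2 t, a < t < b & ~ C t.
Proof.
move=> ab cC; apply: contrapT => nex.
have /countable_lebesgue_measure0 : countable `]a, b[%classic.
  apply: sub_countable cC; apply: subset_card_le => t.
  rewrite /= in_itv /= => tab.
  by apply: contrapT => nCt; apply: nex; exists t.
rewrite lebesgue_measure_itv /= lte_fin ab -EFinB => -[] /eqP.
by rewrite subr_eq0 gt_eqF.
Qed.

(** * Connectedness of a disc minus a countable set *)

Section plane.
Variable R : realType.

Definition plane_pt (x y : R) : 'rV[R]_2 := \row_j (if j == 0 then x else y).

Lemma plane_pt0 x y : plane_pt x y 0 0 = x. Proof. by rewrite mxE. Qed.
Lemma plane_pt1 x y : plane_pt x y 0 1 = y. Proof. by rewrite mxE. Qed.

Lemma ord2P (P : 'I_2 -> Prop) : P 0 -> P 1 -> forall j, P j.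
Proof.
move=> P0 P1 [[|[|//]] lt].
  by rewrite (_ : Ordinal lt = 0)//; exact: val_inj.
by rewrite (_ : Ordinal lt = 1)//; exact: val_inj.
Qed.

Lemma plane_ptE (v : 'rV[R]_2) : v = plane_pt (v 0 0) (v 0 1).
Proof. by apply/rowP; apply: ord2P; rewrite ?plane_pt0 ?plane_pt1. Qed.

Definition plane_segment (q z : 'rV[R]_2) : set 'rV[R]_2 :=
  (fun s : R => q + s *: (z - q)) @` `[0, 1].

Lemma plane_segment_connected q z : connected (plane_segment q z).
Proof.
apply: connected_continuous_connected; first exact: segment_connected.
apply: continuous_subspaceT => s.
apply: (@continuousD _ _ _ (cst q) (fun s : R => s *: (z - q))).
  exact: cst_continuous.
exact: scalel_continuous.
Qed.

Lemma plane_segmentl q z : plane_segment q z q.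
Proof.
by exists 0; [rewrite /= in_itv /= lexx ler01|rewrite scale0r addr0].
Qed.

Lemma plane_segmentr q z : plane_segment q z z.
Proof.
by exists 1; [rewrite /= in_itv /= lexx ler01|rewrite scale1r addrC subrK].
Qed.

Lemma plane_segment_box c e q z :
  rV_box c e q -> rV_box c e z -> plane_segment q z `<=` rV_box c e.
Proof.
move=> cq cz v [s /=]; rewrite in_itv /= => /andP[s0 s1] <- j; rewrite !mxE.
have -> : c 0 j - (q 0 j + s * (z 0 j - q 0 j)) =
   (1 - s) * (c 0 j - q 0 j) + s * (c 0 j - z 0 j) by ring.
rewrite (le_lt_trans (ler_normD _ _))// !normrM (ger0_norm s0).
rewrite ger0_norm ?subr_ge0//.
have cqj := cq j; have czj := cz j.
by have [->|] := eqVneq s 0; nra.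
Qed.

Lemma plane_pt_vertical_continuous x : continuous (plane_pt x).
Proof.
have -> : plane_pt x = fun t => plane_pt x 0 + t *: plane_pt 0 1.
  apply/funext => t; apply/rowP; apply: ord2P; rewrite !mxE /=.
    by rewrite mulr0 addr0.
  by rewrite mulr1 add0r.
move=> s.
apply: (@continuousD _ _ _ (cst (plane_pt x 0)) (fun s : R => s *: _)).
  exact: cst_continuous.
exact: scalel_continuous.
Qed.

(** The points of [C] have only countably many abscissae, so some vertical line through the box
    misses [C]. *)
Lemma plane_box_vertical (c : 'rV[R]_2) e (C : set 'rV[R]_2) :
  0 < e -> countable C -> exists x, [/\ `|c 0 0 - x| < e &
    plane_pt x @` `]c 0 1 - e, c 0 1 + e[ `<=` rV_box c e `\` C].
Proof.
move=> e0 cC.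
have cC0 : countable ((fun v : 'rV[R]_2 => v 0 0) @` C).
  exact: countable_image.
have [|x xe nCx] := @interval_avoid_countable _ (c 0 0 - e) (c 0 0 + e) _ _ cC0.
  by rewrite ltrBlDr -addrA ltrDl addr_gt0.
exists x; split; first by rewrite ltr_distlC.
move=> v [t /=]; rewrite in_itv /= => te <-; split.
  by apply: ord2P; rewrite ?plane_pt0 ?plane_pt1 ltr_distlC.
by move=> Cxt; apply: nCx; exists (plane_pt x t); rewrite ?plane_pt0.
Qed.

(* A point [q] off the good vertical line is joined to it by a segment: the
   slopes are parametrised by the height at which the line is met, and each
   point of [C] rules out at most one of them. *)
Lemma plane_box_minus_countable_connected (c : 'rV[R]_2) e (C : set 'rV[R]_2) :
  0 < e -> countable C -> connected (rV_box c e `\` C).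
Proof.
move=> e0 cC; have [x [cx Lsub]] := plane_box_vertical c e0 cC.
set L := (plane_pt x @` _) in Lsub.
have cee : c 0 1 - e < c 0 1 + e by rewrite ltrBlDr -addrA ltrDl addr_gt0.
have L0 : L (plane_pt x (c 0 1)).
  by exists (c 0 1) => //=; rewrite in_itv /= ltrBlDr ltrDl e0.
have cL : connected L.
  apply: connected_continuous_connected.
    exact/connected_intervalP/interval_is_interval.
  exact/continuous_subspaceT/plane_pt_vertical_continuous.
have [S SP] : {S : 'rV[R]_2 -> set 'rV[R]_2 & forall q, (rV_box c e `\` C) q ->
    [/\ S q q, L `<=` S q, S q `<=` rV_box c e `\` C & connected (S q)]}.
  apply: (@choice _ _ (fun q S => (rV_box c e `\` C) q ->
    [/\ S q, L `<=` S, S `<=` rV_box c e `\` C & connected S])) => q.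
  have [[cq nCq]|nq] := pselect ((rV_box c e `\` C) q); last by exists set0.
  have [q0x|q0x] := eqVneq (q 0 0) x.
    exists L => _; split=> //; exists (q 0 1); last first.
      by rewrite [RHS]plane_ptE q0x.
    by rewrite /= in_itv /= -ltr_distlC; exact: cq.
  (* The height at which the line through [q] and [v] meets the vertical line of abscissa [x]. *)
  pose bad (v : 'rV[R]_2) :=
    q 0 1 + (v 0 1 - q 0 1) * (x - q 0 0) / (v 0 0 - q 0 0).
  have [t te nbad] := interval_avoid_countable cee (countable_image bad cC).
  have Lt : L (plane_pt x t) by exists t.
  exists (L `|` plane_segment q (plane_pt x t)) => _; split.
  - by right; exact: plane_segmentl.
  - exact: subsetUl.
  - rewrite subUset; split=> // v qv; split.
      by apply: plane_segment_box qv => //; have [] := Lsub _ Lt.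
    move=> Cv; have [s /=] := qv; rewrite in_itv /= => s01 vE.
    have [s0|s0] := eqVneq s 0.
      by apply: nCq; move: Cv; rewrite -vE s0 scale0r addr0.
    apply: nbad; exists v => //; rewrite /bad -vE !mxE /=.
    by field; rewrite addrAC subrr add0r mulf_neq0// subr_eq0 eq_sym.
  - apply: connectedU => //; last exact: plane_segment_connected.
    by exists (plane_pt x t); split=> //; exact: plane_segmentr.
(* The connected sets [S q] all contain [L], hence a common point, and together they exhaust the
   punctured box. *)
have -> : rV_box c e `\` C = \bigcup_(q in rV_box c e `\` C) S q.
  apply/seteqP; split=> [q Cq|v [q /SP[_ _ sub _] /sub//]].
  by exists q => //; have [] := SP q Cq.
apply: bigcup_connected; last by move=> q /SP[].
by exists (plane_pt x (c 0 1)) => q /SP[_ sub _ _]; exact: sub.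
Qed.

Variables (T : topologicalType) (A : set T).
Hypotheses (eT : locally_euclidean R 2 T) (cA : countable A).

(** [U] is the image of a small box in a chart; in the chart, removing [A] amounts to removing the
    countable set [C]. *)
Lemma locally_connected_minus_countable (w : T) (O : set T) :
  open O -> O w -> exists U,
    [/\ open U, U w, U `<=` O, connected (U `\` A) & U `\` A !=set0].
Proof.
move=> oO Ow.
have /locally_euclidean_chart/(_ w)[U [D [f [g [h Uw]]]]] := eT.
have [ oU oD fP gP] := h.
have [Dfw gfw _] := fP w Uw.
have oDO : open (D `&` g @^-1` O).
  by apply: open_preimage_in => // z /gP[].
have [|e e0 eDO] := @nbhs_sub_rV_box _ _ (f w) (D `&` g @^-1` O).
  by apply: open_nbhs_nbhs; split=> //; split=> //=; rewrite gfw.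
pose C := f @` (A `&` U).
have cC : countable C.
  by apply/countable_image/(sub_countable _ cA)/subset_card_le => z [].
have gE : g @` rV_box (f w) e `\` A = g @` (rV_box (f w) e `\` C).
  apply/seteqP; split=> [_ [[v ev <-] nA]|_ [v [ev nC] <-]].
    exists v => //; split=> // -[a [Aa Ua] fav]; apply: nA.
    by rewrite -fav; have [_ -> _] := fP a Ua.
  split; first by exists v.
  move=> Agv; apply: nC; have [Dv _] := eDO v ev.
  by have [Ugv fgv _] := gP v Dv; exists (g v).
exists (g @` rV_box (f w) e); split.
- apply: (partial_homeo_image_open (partial_homeo_sym h)).
    exact: open_rV_box.
  by move=> v /eDO[].
- by exists (f w) => //; exact: rV_box_center.
- by move=> _ [v /eDO[_ ?] <-].
- rewrite gE; apply: connected_continuous_connected.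
    exact: plane_box_minus_countable_connected.
  apply: continuous_in_subspaceT => v /[!inE] -[/eDO[Dv _] _].
  by have [] := gP v Dv.
- rewrite gE; have [x [_ sub]] := plane_box_vertical (f w) e0 cC.
  exists (g (plane_pt x (f w 0 1))), (plane_pt x (f w 0 1)) => //.
  apply: sub; exists (f w 0 1) => //=.
  by rewrite in_itv /= ltrBlDr ltrDl e0.
Qed.

Lemma dense_setC_countable : dense (~` A).
Proof.
move=> O [w Ow] oO.
have [U [_ _ UO _ [y [Uy nAy]]]] := locally_connected_minus_countable oO Ow.
by exists y; split=> //; exact: UO.
Qed.

End plane.

(** * Extending a covering across the punctures *)

Section sheets.
Variables (X Y : topologicalType) (q : X -> Y) (A : set Y).

(** [U] is open in the unpunctured space when it carries sheets. No homeomorphism is required: [q]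
    will be continuous and open onto the complement of [A], so injectivity on the open set [V]
    suffices. *)
Definition sheet (U : set Y) (V : set X) : Prop :=
  [/\ open V, forall x x', V x -> V x' -> q x = q x' -> x = x',
      V `<=` q @^-1` U & U `\` A `<=` q @` V].

Definition sheets (U : set Y) (F : set (set X)) : Prop :=
  [/\ open U, F `<=` sheet U, trivIset F id &
      q @^-1` U = \bigcup_(V in F) V].

(** For [w] in [A] this filter stands for the missing point of the sheet [V] over [w]. *)
Definition germ (V : set X) (w : Y) : set (set X) :=
  [set S | exists2 U, open_nbhs w U & V `&` q @^-1` U `<=` S].

Lemma germ_self V w : germ V w V.
Proof. by exists setT => [|x []//]; split=> //; exact: openT. Qed.

Lemma germT V w : germ V w setT.
Proof. by exists setT => //; split=> //; exact: openT. Qed.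

Lemma germI V w S S' : germ V w S -> germ V w S' -> germ V w (S `&` S').
Proof.
move=> [U [oU Uw] US] [U' [oU' U'w] US']; exists (U `&` U').
  by split=> //; exact: openI.
by move=> x [Vx [Ux U'x]]; split; [exact: US|exact: US'].
Qed.

Lemma germS V w S S' : S `<=` S' -> germ V w S -> germ V w S'.
Proof. by move=> SS' [U wU US]; exists U => //; exact: subset_trans SS'. Qed.

Lemma sub_germ V V' w U : open_nbhs w U ->
  V `&` q @^-1` U `<=` V' -> germ V' w `<=` germ V w.
Proof.
move=> [oU Uw] VV' S [U' [oU' U'w] U'S]; exists (U `&` U').
  by split=> //; exact: openI.
move=> x [Vx [Ux U'x]]; apply: U'S; split=> //.
exact: VV'.
Qed.

(** The sheet occurs only under an existential and the filter is the data, so sheets with the same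
    germ give equal points: the gluing needs no quotient. *)
Record extension := Extension {
  base : Y;
  germ_at : set (set X);
  extensionP : exists U F V,
    [/\ sheets U F, F V, U base & germ_at = germ V base] }.

Lemma extension_eq (z z' : extension) :
  base z = base z' -> germ_at z = germ_at z' -> z = z'.
Proof.
case: z z' => [w S p] [w' S' p'] /= ww' SS'; subst w' S'.
by congr Extension; exact: Prop_irrelevance.
Qed.

(** When [S] is one of the sheets over [U], this is the completed copy of [U]. *)
Definition basic_open (U : set Y) (S : set X) : set extension :=
  [set z | U (base z) /\ germ_at z S].

Definition extension_open (O : set extension) : Prop :=
  forall z, O z -> exists U S,
    [/\ open U, open S, basic_open U S z & basic_open U S `<=` O].

Lemma extension_openT : extension_open setT.
Proof.
move=> z _; exists setT, setT; split=> //; [exact: openT|exact: openT|].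
by split=> //; have [U [F [V [_ _ _ ->]]]] := extensionP z; exact: germT.
Qed.

Lemma basic_openI U U' S S' : basic_open (U `&` U') (S `&` S') =
  basic_open U S `&` basic_open U' S'.
Proof.
apply/seteqP; split=> z; rewrite /basic_open /=;
  have [_ [_ [V [_ _ _ ->]]]] := extensionP z.
  by move=> [[? ?] h]; split; split=> //; apply: germS h => x [].
by move=> [[? ?] [? ?]]; split=> //; exact: germI.
Qed.

Lemma extension_openI : setI_closed extension_open.
Proof.
move=> O O' oO oO' z [Oz O'z].
have [U [S [oU oS zUS sub]]] := oO z Oz.
have [U' [S' [oU' oS' zUS' sub']]] := oO' z O'z.
exists (U `&` U'), (S `&` S'); rewrite basic_openI; split=> //.
- exact: openI.
- exact: openI.
- exact: setISS.
Qed.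

Lemma extension_open_bigU (I : Type) (f : I -> set extension) :
  (forall i, extension_open (f i)) -> extension_open (\bigcup_i f i).
Proof.
move=> of_ z [i _ fiz]; have [U [S [oU oS zUS sub]]] := of_ i z fiz.
by exists U, S; split=> // z' /sub ?; exists i.
Qed.

HB.instance Definition _ := gen_eqMixin extension.
HB.instance Definition _ := gen_choiceMixin extension.
HB.instance Definition _ := isOpenTopological.Build extension
  extension_openT extension_openI extension_open_bigU.

Lemma open_extensionE (O : set extension) : open O = extension_open O.
Proof. by []. Qed.

Lemma open_basic_open U S : open U -> open S -> open (basic_open U S).
Proof.
by move=> oU oS; rewrite open_extensionE => z zUS; exists U, S; split.
Qed.

Lemma base_continuous : continuous base.
Proof.
apply/continuousP => O oO; have -> : base @^-1` O = basic_open O setT.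
  apply/seteqP; split=> z; last by case.
  by split=> //; have [_ [_ [V [_ _ _ ->]]]] := extensionP z; exact: germT.
by apply: open_basic_open => //; exact: openT.
Qed.

(** * Uniqueness of sheets and local structure of the glued space *)

Hypothesis q_continuous : continuous q.
Hypothesis q_range : range q = ~` A.
Hypothesis q_open : forall O, open O -> exists2 O', open O' & q @` O = O' `\` A.
Hypothesis connected_nbhs : forall w O, open O -> O w -> exists U,
  [/\ open U, U w, U `<=` O, connected (U `\` A) & U `\` A !=set0].
Hypothesis q_sheets : forall y, ~ A y -> exists U F, sheets U F /\ U y.

Lemma q_notin x : ~ A (q x).
Proof. by have : range q (q x) by []; rewrite q_range. Qed.

(** Every neighbourhood of [w] contains points off [A], and the sheet has points over them. *)
Lemma germ_nonempty U V w S : open U -> sheet U V -> U w -> germ V w S ->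
  S !=set0.
Proof.
move=> oU [_ _ _ UV] Uw [U' [oU' U'w] U'S].
have [|U2 [_ _ sub _ [y [U2y nAy]]]] := connected_nbhs (openI oU oU') (w := w).
  by [].
have [Uy U'y] := sub y U2y; have [//|x Vx xy] := UV y.
by exists x; apply: U'S; split=> //=; rewrite xy.
Qed.

(** [V] and [V'] both belong to the germ of [V], so they meet; members of [F] that meet are
    equal. *)
Lemma germ_sheet_inj U F V V' w :
  sheets U F -> F V -> F V' -> U w -> germ V w V' -> V = V'.
Proof.
move=> [oU FU tF _] FV FV' Uw VV'.
have := germ_nonempty oU (FU _ FV) Uw (germI (germ_self V w) VV').
exact: tF.
Qed.

(** The trace of [O] on [C] is also the trace of the closed complement of [O'], hence open and
    closed in [C]. *)
Lemma connected_subset_open (C O O' : set Y) :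
  connected C -> open O -> open O' -> C `<=` O `|` O' ->
  C `&` O `&` O' = set0 -> C `&` O !=set0 -> C `<=` O.
Proof.
move=> cC oO oO' COO' dis C0.
suff <- : C `&` O = C by move=> x [].
apply: cC => //; first by exists O.
exists (~` O'); first exact: open_closedC.
apply/seteqP; split=> x [Cx] => [Ox|nO'x]; split=> //.
  by move=> O'x; have : (C `&` O `&` O') x by []; rewrite dis.
by have [] := COO' x Cx.
Qed.

(* Over a connected piece of the base, the sheet [V1] cannot jump from one
   sheet of [F] to another. *)
Lemma sheets_germ U F U1 F1 V1 w : sheets U F -> sheets U1 F1 -> F1 V1 ->
  U w -> U1 w -> exists2 V, F V & germ V1 w = germ V w.
Proof.
move=> [oU FU tF UF] [oU1 FU1 _ _] FV1 Uw U1w.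
have [|U2 [oU2 U2w sub cC [y [U2y nAy]]]] :=
  connected_nbhs (openI oU oU1) (w := w); first by [].
have [oV1 V1inj V1U V1A] := FU1 _ FV1.
have lift y' : (U2 `\` A) y' -> exists x, exists V,
    [/\ V1 x, q x = y', F V & V x].
  move=> [/sub[Uy' U1y'] nAy']; have [//|x V1x xy'] := V1A y'.
  have [V FV Vx] : (\bigcup_(V in F) V) x by rewrite -UF /= xy'.
  by exists x, V.
have [x [V [V1x xy FV Vx]]] := lift y (conj U2y nAy).
have [oV Vinj VU VA] := FU _ FV.
(* Off [A], [O] is where [V1] runs in [V], and [O'] below is where it runs in another member of [F].
   They cover the connected set and are disjoint on it. *)
have [ O oO OE] := q_open (openI oV oV1).
have oW : open (\bigcup_(V' in F `\ V) V').
  by apply: bigcup_open => V' [FV' _]; have [] := FU _ FV'.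
have [ O' oO' OE'] := q_open (openI oV1 oW).
have CO : U2 `\` A `<=` O.
  apply: (connected_subset_open cC oO oO').
  - move=> y' Cy'; have [x' [V' [V1x' xy' FV' Vx']]] := lift y' Cy'.
    have [VV'|VV'] := pselect (V' = V).
      have : (q @` (V `&` V1)) y' by exists x' => //; split=> //; rewrite -VV'.
      by rewrite OE => -[]; left.
    have : (q @` (V1 `&` \bigcup_(V' in F `\ V) V')) y'.
      by exists x' => //; split=> //; exists V'.
    by rewrite OE' => -[]; right.
  - apply/seteqP; split=> // y' [[[_ nAy'] Oy'] O'y'].
    have : (q @` (V `&` V1)) y' by rewrite OE.
    move=> [x' [Vx' V1x'] xy'].
    have : (q @` (V1 `&` \bigcup_(V' in F `\ V) V')) y' by rewrite OE'.
    move=> [x2 [V1x2 [V' [FV' VV'] V'x2]] x2y'].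
    have x2x' : x2 = x' by apply: V1inj; rewrite // x2y'.
    by apply/VV'/esym/tF => //; exists x'; split=> //; rewrite -x2x'.
  - exists y; split=> //.
    have : (q @` (V `&` V1)) y by exists x.
    by rewrite OE => -[].
(* Hence [V] and [V1] coincide over [U2], and their germs at [w] agree. *)
have V1V : V1 `&` q @^-1` U2 `<=` V.
  move=> x' [V1x' U2x'].
  have : (q @` (V `&` V1)) (q x').
    by rewrite OE; split; [apply: CO; split|]=> //; exact: q_notin.
  by move=> [x2 [Vx2 V1x2] /V1inj <-].
have VV1 : V `&` q @^-1` U2 `<=` V1.
  move=> x' [Vx' U2x'].
  have : (q @` (V `&` V1)) (q x').
    by rewrite OE; split; [apply: CO; split|]=> //; exact: q_notin.
  by move=> [x2 [Vx2 V1x2] /Vinj <-].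
by exists V => //; apply/seteqP; split; apply: (sub_germ (U := U2)).
Qed.

Lemma germ_at_sheet U F z : sheets U F -> U (base z) ->
  exists2 V, F V & germ_at z = germ V (base z).
Proof.
move=> hF Uz; have [U1 [F1 [V1 [hF1 FV1 U1z ->]]]] := extensionP z.
exact: sheets_germ hF hF1 FV1 Uz U1z.
Qed.

Lemma basic_open_germ U F V z : sheets U F -> F V -> basic_open U V z ->
  germ_at z = germ V (base z).
Proof.
move=> hF FV [Uz zV]; have [V' FV' zV'] := germ_at_sheet hF Uz.
by rewrite zV'; move: zV; rewrite zV' => /(germ_sheet_inj hF FV' FV Uz) ->.
Qed.

(** The inverse sends [y] to the germ of [V] at [y]; the point [w] supplies its default value
    outside [U]. *)
Lemma base_partial_homeo U F V w : sheets U F -> F V -> U w ->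
  exists s, partial_homeo (basic_open U V) U base s.
Proof.
move=> hF FV Uw; have [oU FU tF UF] := hF.
have [oV Vinj VU VA] := FU _ FV.
have mk y : U y -> exists U F V',
    [/\ sheets U F, F V', U y & germ V y = germ V' y].
  by move=> Uy; exists U, F, V.
pose s y := if pselect (U y) is left Uy then Extension (mk y Uy)
            else Extension (mk w Uw).
have sP y : U y -> base (s y) = y /\ germ_at (s y) = germ V y.
  by rewrite /s; case: pselect.
exists s; split=> //; first exact: open_basic_open.
  move=> z zUV; have [Uz zV] := zUV.
  split=> //; last exact: base_continuous.
  have [e1 e2] := sP _ Uz; apply: extension_eq => //.
  by rewrite e2 (basic_open_germ hF FV zUV).
move=> y Uy; have [e1 e2] := sP _ Uy; split=> //.
  by split; rewrite ?e1 ?e2 //; exact: germ_self.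
move=> O'; rewrite nbhsE /= => -[ O [+ Osy] OO'].
rewrite open_extensionE => oO.
have [U' [S [oU' oS [U'y yS] sub]]] := oO _ Osy.
rewrite e1 in U'y; move: yS; rewrite e2 => -[U2 [oU2 U2y] U2S].
(* The set [U2] witnessing that [S] is in the germ at [y] is a witness at each of its points. *)
apply: (@filterS _ _ _ (U `&` U' `&` U2)).
  move=> y' [[Uy' U'y'] U2y'] /=; apply/OO'/sub.
  have [e1' e2'] := sP _ Uy'; split; rewrite ?e1' ?e2' //.
  by exists U2.
by apply: open_nbhs_nbhs; split=> //; apply: openI => //; exact: openI.
Qed.

(** As [q] is continuous, open off [A] and injective on [V], the neighbourhoods of [x] are generated
    by the traces on [V] of neighbourhoods of [q x]. Points of [X] thereby become points of the
    extension. *)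
Lemma nbhs_germ U V x : open U -> sheet U V -> V x -> nbhs x = germ V (q x).
Proof.
move=> oU [oV Vinj VU VA] Vx; apply/seteqP; split=> S.
  rewrite nbhsE => -[ O [oO Ox] OS].
  have [ O' oO' OE] := q_open (openI oO oV).
  exists O'.
    split=> //; have : (q @` (O `&` V)) (q x) by exists x.
    by rewrite OE => -[].
  move=> x' [Vx' O'x']; have : (q @` (O `&` V)) (q x').
    by rewrite OE; split=> //; exact: q_notin.
  by move=> [x2 [Ox2 Vx2] /Vinj <-//]; exact: OS.
move=> [U' [oU' U'x] U'S]; apply: (filterS U'S).
apply: open_nbhs_nbhs; split=> //; apply: openI => //.
by move/continuousP: q_continuous; apply.
Qed.

Lemma sheet_through x : exists U F V, [/\ sheets U F, F V, U (q x) & V x].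
Proof.
have [U [F [hF Ux]]] := q_sheets (@q_notin x); have [_ _ _ UF] := hF.
have [V FV Vx] : (\bigcup_(V in F) V) x by rewrite -UF.
by exists U, F, V.
Qed.

Lemma nbhs_germ_at x : exists U F V,
  [/\ sheets U F, F V, U (q x) & nbhs x = germ V (q x) :> set (set X)].
Proof.
have [U [F [V [hF FV Ux Vx]]]] := sheet_through x.
exists U, F, V; split=> //; have [oU FU _ _] := hF.
exact: nbhs_germ (FU _ FV) Vx.
Qed.

(** * Embedding of the total space and separation *)

Definition to_extension x := Extension (nbhs_germ_at x).

Lemma to_extension_continuous : continuous to_extension.
Proof.
apply/continuousP => O; rewrite open_extensionE => oO.
rewrite openE => x Ox.
have [U [S [oU oS [/= Ux xS] sub]]] := oO _ Ox.
apply: (@filterS _ _ _ (S° `&` q @^-1` U)).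
  by move=> x' [Sx' Ux']; apply: sub; split.
apply: filterI.
  by apply: open_nbhs_nbhs; split=> //; exact: open_interior.
by apply: q_continuous; exact: open_nbhs_nbhs.
Qed.

Lemma to_extension_embedding : embedding to_extension.
Proof.
apply: embedding_of_preimages.
- exact: to_extension_continuous.
- move=> x x' [xx' nxx'].
  have [U [F [V [hF FV Ux Vx]]]] := sheet_through x.
  have [oU FU _ _] := hF; have [oV Vinj _ _] := FU _ FV.
  apply: Vinj => //; apply: nbhs_singleton.
  by rewrite -nxx'; exact: open_nbhs_nbhs.
(* An open [S] consists exactly of the points whose neighbourhood filter contains it. *)
- move=> S oS; exists (basic_open setT S).
    by apply: open_basic_open => //; exact: openT.
  apply/seteqP; split=> x.
    by move=> Sx; split=> //; exact: open_nbhs_nbhs.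
  by move=> [_] /=; exact: nbhs_singleton.
Qed.

Lemma range_to_extension : ~` range to_extension = base @^-1` A.
Proof.
apply/seteqP; split=> [z nz|z Az [x _ xz]]; last first.
  by apply: (@q_notin x); rewrite -[q x]/(base (to_extension x)) xz.
apply: contrapT => nAz; apply: nz.
have [U [F [V [hF FV Uz zV]]]] := extensionP z.
have [oU FU _ _] := hF; have hV := FU _ FV; have [_ _ _ VA] := hV.
have [//|x Vx xz] := VA (base z).
exists x => //; apply: extension_eq => //=.
by rewrite zV -xz (nbhs_germ oU hV Vx).
Qed.

(** Points over different base points are separated in [Y]; points over the same one lie in
    different, hence disjoint, completed sheets over a common [U]. *)
Lemma extension_hausdorff : hausdorff_space Y -> hausdorff_space extension.
Proof.
rewrite !open_hausdorff => hY z z' zz'.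
have [bb|/eqP/hY[[U U'] /= [/[!inE] Uz U'z'] [oU oU' UU']]] :=
    pselect (base z = base z'); last first.
  exists (base @^-1` U, base @^-1` U') => /=; first by rewrite !inE.
  split.
  - by move/continuousP: base_continuous; apply.
  - by move/continuousP: base_continuous; apply.
  - by rewrite -preimage_setI UU' preimage_set0.
have [U [F [V [hF FV Uz zV]]]] := extensionP z.
have [oU FU tF _] := hF.
have Uz' : U (base z') by rewrite -bb.
have [V' FV' zV'] := germ_at_sheet hF Uz'.
have oV W : F W -> open W by move=> /FU[].
exists (basic_open U V, basic_open U V') => /=.
  by rewrite !inE; split; split; rewrite ?zV ?zV' //; exact: germ_self.
split; [by apply: open_basic_open; auto|by apply: open_basic_open; auto|].
apply/eqP/seteqP; split=> // y [yV yV'].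
have /eqP := zz'; apply; apply: extension_eq => //.
rewrite zV zV' bb; congr (germ _ _).
have [Uy hV'] := yV'; apply: (germ_sheet_inj hF FV FV' Uy).
by rewrite -(basic_open_germ hF FV yV).
Qed.

(** * Countability and density *)

Hypothesis sheets_countable : forall U F, sheets U F -> countable F.

Lemma extension_second_countable :
  @second_countable Y -> @second_countable extension.
Proof.
move=> [B cB bB].
(* One family of sheets is fixed for each small basic set; by uniqueness of germs these countably
   many sheets describe all points. *)
have [Fb FbP] : {Fb : set Y -> set (set X) & forall b,
    (exists2 U, exists F, sheets U F & b `<=` U) ->
    exists2 U, sheets U (Fb b) & b `<=` U}.
  apply: (@choice _ _ (fun b F =>
    (exists2 U, exists F, sheets U F & b `<=` U) ->
    exists2 U, sheets U F & b `<=` U)) => b.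
  have [[U [F hF] bU]|nb] :=
      pselect (exists2 U, exists F, sheets U F & b `<=` U).
    by exists F => _; exists U.
  by exists set0.
pose B' := [set b | B b /\ exists2 U, exists F, sheets U F & b `<=` U].
exists ((fun bV => basic_open bV.1 bV.2) @` (B `*` \bigcup_(b in B') Fb b)).
  apply/countable_image/countableX => //; apply: bigcup_countable.
    by apply: sub_countable cB; apply: subset_card_le => b [].
  by move=> b [_ /FbP[U hF _]]; exact: sheets_countable hF.
apply: basisP => [_ [[b V] [/= Bb [b' [_ /FbP[U hF _]] FV]] <-]|z O].
  apply: open_basic_open; first exact: (proj1 bB).
  by have [_ /(_ _ FV)[]] := hF.
rewrite open_extensionE => oO Oz.
have [U0 [S [oU0 oS [U0z zS] sub]]] := oO z Oz.
have [U [F [_ [hF _ Uz _]]]] := extensionP z.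
have [oU _ _ _] := hF.
have [b [Bb bz bU]] := basis_sub bB oU Uz.
have hb : exists2 U, exists F, sheets U F & b `<=` U.
  by exists U => //; exists F.
have [U1 hF1 bU1] := FbP b hb.
have [V FV zV] := germ_at_sheet hF1 (bU1 _ bz).
move: zS; rewrite zV => -[U2 [oU2 U2z] U2S].
(* The sheet [V] chosen for [b] is kept, and only the base is shrunk, until the trace of [V] over
   [b'] lies in [S]. *)
have [b' [Bb' b'z b'sub]] := basis_sub bB (openI oU0 oU2) (conj U0z U2z).
exists (basic_open b' V); split.
- by exists (b', V) => //; split=> //; exists b.
- by split=> //; rewrite zV; exact: germ_self.
- apply: subset_trans sub => z' [b'z' z'V]; split.
    by have [] := b'sub _ b'z'.
  move: z'V; have [_ [_ [V' [_ _ _ ->]]]] := extensionP z' => z'V.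
  have z'b' : germ V' (base z') (q @^-1` b').
    exists b'; last by move=> x [].
    by split=> //; exact: (proj1 bB).
  apply: germS (germI z'V z'b') => x [Vx b'x]; apply: U2S; split=> //.
  by have [] := b'sub _ b'x.
Qed.

(** Each point of a fibre is determined by a sheet of one countable family. *)
Lemma base_preimage_countable : countable A -> countable (base @^-1` A).
Proof.
move=> cA; have -> : base @^-1` A = \bigcup_(a in A) base @^-1` [set a].
  apply/seteqP; split=> [z Az|z [a Aa /= ->]//].
  by exists (base z).
apply: bigcup_countable => // a _.
have [[z0 /= z0a]|na] := pselect (exists z, base z = a); last first.
  apply: sub_countable (countable0 extension); apply: subset_card_le => z za.
  by apply: na; exists z.
have [U [F [_ [hF _ Uz0 _]]]] := extensionP z0.
rewrite z0a in Uz0.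
apply: (@sub_countable _ _ _ (\bigcup_(V in F) 
    [set z | base z = a /\ germ_at z = germ V a])).
  apply: subset_card_le => z /= za.
  have [|V FV zV] := @germ_at_sheet _ _ z hF; first by rewrite za.
  by exists V => //; split=> //; rewrite -za.
apply: bigcup_countable; first exact: sheets_countable hF.
move=> V FV; apply: countable_subsingleton => z z' /= [za zV] [z'a z'V].
by apply: extension_eq; rewrite ?za ?zV.
Qed.

Hypothesis A_dense : dense A.

(** [base] is locally a homeomorphism, so a nonempty open set has an image with interior, which
    meets [A]. *)
Lemma base_preimage_dense : dense (base @^-1` A).
Proof.
move=> O [z Oz] oO; have [U [F [V [hF FV Uz zV]]]] := extensionP z.
have [s hs] := base_partial_homeo hF FV Uz.
have [oUV oU sP _] := hs.
have zUV : basic_open U V z by split=> //; rewrite zV; exact: germ_self.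
have oO' : open (base @` (O `&` basic_open U V)).
  by apply: (partial_homeo_image_open hs); [exact: openI|move=> y []].
have [|_ [[y [Oy _] <-] Ay]] := A_dense _ oO'.
  by exists (base z), z.
by exists y.
Qed.

(** * The completed covering *)

Definition sheeted : set Y := [set y | exists U F, sheets U F /\ U y].

Lemma open_sheeted : open sheeted.
Proof.
rewrite openE => y [U [F [hF Uy]]]; have [oU _ _ _] := hF.
apply: (@filterS _ _ _ U); first by move=> y' Uy'; exists U, F.
exact: open_nbhs_nbhs.
Qed.

Lemma base_sheeted z : base z \in sheeted.
Proof.
by apply/mem_set; have [U [F [V [hF _ Uz _]]]] := extensionP z; exists U, F.
Qed.

Definition projection z : sheeted := SigSub (base_sheeted z).

Lemma projection_continuous : continuous projection.
Proof. exact/continuous_into_set_type/base_continuous. Qed.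

Lemma projection_partial_homeo U F V w : sheets U F -> F V -> U w ->
  exists s, partial_homeo (basic_open U V) (set_val @^-1` U) projection s.
Proof.
move=> hF FV Uw; have [s [oUV oU bP sP]] := base_partial_homeo hF FV Uw.
exists (s \o set_val); split=> //.
- exact: open_set_val_preimage.
- move=> z /bP[Uz sz _]; split=> //; exact: projection_continuous.
- move=> y Uy; have [UVy sy cs] := sP _ Uy; split=> //.
    exact: set_type_inj.
  by apply: continuous_comp => //; exact: set_val_continuous.
Qed.

(** A neighbourhood [U] contains a point off [A], and [q] attains it. Surjectivity over the
    punctures rests on this. *)
Lemma sheet_nonempty U F y : sheets U F -> U y -> F !=set0.
Proof.
move=> [oU _ _ UF] Uy.
have [U2 [_ _ sub _ [y' [U2y' nAy']]]] := connected_nbhs oU Uy.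
have [x _ xy'] : range q y' by rewrite q_range.
have [V FV _] : (\bigcup_(V in F) V) x.
  by rewrite -UF /= xy'; exact: sub.
by exists V.
Qed.

Lemma projection_covering : covering_projection projection.
Proof.
split; first exact: projection_continuous.
  apply/seteqP; split=> // y _.
  have [U [F [hF Uy]]] := set_valP y.
  have [V FV] := sheet_nonempty hF Uy.
  have [s [_ _ _ sP]] := projection_partial_homeo hF FV Uy.
  by exists (s y) => //; have [] := sP _ Uy.
move=> y; have [U [F [hF Uy]]] := set_valP y.
have [oU FU tF _] := hF.
exists (set_val @^-1` U); first by split=> //; exact: open_set_val_preimage.
(* The completed sheets over [U] are disjoint because a germ determines its member of [F], and they
   cover because every point over [U] has a germ from [F]. *)
exists (basic_open U @` F); split.
- by move=> _ [V /FU[oV _ _ _] <-]; exact: open_basic_open.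
- move=> _ _ [V FV <-] [V' FV' <-] [z [zV zV']]; congr basic_open.
  have [Uz hV'] := zV'; apply: (germ_sheet_inj hF FV FV' Uz).
  by rewrite -(basic_open_germ hF FV zV).
- apply/seteqP; split=> [z Uz|z [_ [V _ <-] []]//].
  have [V FV zV] := germ_at_sheet hF Uz.
  exists (basic_open U V); first by exists V.
  by split=> //; rewrite zV; exact: germ_self.
- move=> _ [V FV <-]; have [s hs] := projection_partial_homeo hF FV Uy.
  exact: partial_homeo_maps hs.
Qed.

End sheets.

(** * Coverings of perforated surfaces *)

Lemma set_type_hausdorff (T : topologicalType) (W : set T) :
  hausdorff_space T -> hausdorff_space W.
Proof.
rewrite !open_hausdorff => hT x y /eqP xy.
have /eqP/hT[[U V] /= [/[!inE] Ux Vy] [ oU oV UV]] : set_val x <> set_val y.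
  by move/set_type_inj.
exists (set_val @^-1` U, set_val @^-1` V) => /=; first by rewrite !inE.
split; [exact: open_set_val_preimage|exact: open_set_val_preimage|].
by rewrite -preimage_setI UV preimage_set0.
Qed.

Lemma open_set_type_partial_homeo (T : topologicalType) (W : set T) (w : W) :
  open W -> exists k, partial_homeo [set: W] W set_val k.
Proof.
move=> oW.
pose k y := if pselect (W y) is left Wy then SigSub (mem_set Wy) else w.
have kE u : k (set_val u) = u.
  rewrite /k; case: pselect => [Wu|/(_ (set_valP u))//].
  exact: set_type_inj.
exists k; split=> // [|u _|y Wy].
- exact: openT.
- by split; [exact: set_valP|exact: kE|exact: set_val_continuous].
- split=> //; first exact: (congr1 set_val (kE (SigSub (mem_set Wy)))).
  have cid : continuous (id : W -> W) by move=> x; exact: cvg_id.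
  by apply: (continuous_extend_open oW cid kE); exact/mem_set.
Qed.

Lemma countable_dense_open_set_type (T : topologicalType) (W A : set T) :
  open W -> countable_dense A -> countable_dense (set_val @^-1` A : set W).
Proof.
move=> oW [cA dA]; split.
  exact: countable_preimage_inj (@set_type_inj _ _) cA.
move=> O [w Ow] /open_set_typeP[ O' oO' OE].
have [|y [[ O'y Wy] Ay]] := dA (O' `&` W) _ (openI oO' oW).
  by exists (set_val w); split; [move: Ow; rewrite OE|exact: set_valP].
by exists (SigSub (mem_set Wy)); split=> //; rewrite OE.
Qed.

Lemma maps_homeomorphically_image_open (X Y : topologicalType) (f : X -> Y)
    (V : set X) (U : set Y) (O : set X) :
  open U -> maps_homeomorphically f V U -> open O -> open (f @` (O `&` V)).
Proof.
move=> oU [h [g [ch cg hg gh]] hE] oO.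
have /continuousP/(_ _ (open_set_val_preimage V oO)) := cg.
move=> /open_set_typeP[E oE EE].
suff -> : f @` (O `&` V) = E `&` U by exact: openI.
apply/seteqP; split=> [_ [x [ Ox Vx] <-]|y [Ey Uy]].
  pose v : V := SigSub (mem_set Vx).
  have hv : set_val (h v) = f x by rewrite hE.
  split; last by rewrite -hv; exact: set_valP.
  suff : (set_val @^-1` E) (h v) by rewrite /= hv.
  by rewrite -EE /= hg.
pose u : U := SigSub (mem_set Uy).
have : (set_val @^-1` E) u by [].
rewrite -EE /= => Ogu; exists (set_val (g u)).
  by split=> //; exact: set_valP.
by rewrite -hE gh.
Qed.

Lemma covering_projection_image_open (X Y : topologicalType) (p : X -> Y) O :
  covering_projection p -> open O -> open (p @` O).
Proof.
move=> [_ _ ev] oO; rewrite openE => _ [x Ox <-].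
have [U [ oU Upx] [F [FO _ UF FU]]] := ev (p x).
have [V FV Vx] : (\bigcup_(V in F) V) x by rewrite -UF.
apply: (@filterS _ _ _ (p @` (O `&` V))).
  by move=> _ [z [ Oz _] <-]; exists z.
apply: open_nbhs_nbhs; split; last by exists x.
exact: maps_homeomorphically_image_open (FU _ FV) oO.
Qed.

Lemma maps_homeomorphically_inj (X Y : topologicalType) (f : X -> Y)
    (V : set X) (U : set Y) x x' :
  maps_homeomorphically f V U -> V x -> V x' -> f x = f x' -> x = x'.
Proof.
move=> [h [g [_ _ hg _]] hE] Vx Vx' fxx'.
have := can_inj hg (x1 := SigSub (mem_set Vx)) (x2 := SigSub (mem_set Vx')).
move=> /(_ _)/(congr1 set_val); apply.
by apply: set_type_inj; rewrite !hE.
Qed.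

Lemma maps_homeomorphically_image (X Y : topologicalType) (f : X -> Y)
    (V : set X) (U : set Y) :
  maps_homeomorphically f V U -> f @` V = U.
Proof.
move=> [h [g [_ _ _ gh]] hE]; apply/seteqP; split=> [_ [x Vx <-]|y Uy].
  rewrite (_ : f x = set_val (h (SigSub (mem_set Vx)))) ?hE//.
  rewrite -(hE (SigSub (mem_set Vx))); exact: set_valP.
exists (set_val (g (SigSub (mem_set Uy)))); first exact: set_valP.
by rewrite -hE gh.
Qed.

(** Each nonempty member is the trace of an open set of [T] containing some [a] in [A]. Two members
    cannot share [a]: the two open sets would overlap, and by density of the complement so would the
    traces. *)
Lemma disjoint_open_countable (T : topologicalType) (A : set T)
    (F : set (set (~` A : set T))) :
  countable_dense A -> dense (~` A) -> F `<=` open -> trivIset F id ->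
  countable F.
Proof.
move=> [cA dA] dAC oF tF.
pose G a := [set V | F V /\
  exists V', [/\ open V', V' a & V = set_val @^-1` V']].
apply: (@sub_countable _ _ _ ([set set0] `|` \bigcup_(a in A) G a)).
  apply: subset_card_le => V FV.
  have [->|/set0P[x Vx]] := eqVneq V set0; [by left|right].
  have /open_set_typeP[V' oV' VE] := oF _ FV.
  have [|a [V'a Aa]] := dA V' _ oV'.
    by exists (set_val x); move: Vx; rewrite VE.
  by exists a => //; split=> //; exists V'.
rewrite -bigcup2E; apply: bigcup_countable => // -[|[|i]] _ /=.
- exact: countable1.
- apply: bigcup_countable => // a Aa.
  apply: countable_subsingleton => V W.
  move=> [FV [V' [ oV' V'a VE]]] [FW [W' [oW' W'a WE]]].
  have [|y [[V'y W'y] nAy]] := dAC (V' `&` W') _ (openI oV' oW').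
    by exists a.
  apply: tF => //; exists (SigSub (mem_set nAy)).
  by rewrite VE WE.
- exact: countable0.
Qed.

Theorem theorem3p6 (R : realType) (Sigma0 Sigma1 : topologicalType)
    (hSigma0 : connected_surface R Sigma0)
    (hSigma1 : connected_surface R Sigma1)
    (A0 : set Sigma0) (A1 : set Sigma1)
    (hA0 : countable_dense A0) (hA1 : countable_dense A1)
    (p : perforated A1 -> perforated A0) (hp : covering_projection p) :
  exists (Sigma0' Sigma1' : topologicalType) (p' : Sigma1' -> Sigma0')
      (i0 : perforated A0 -> Sigma0') (i1 : perforated A1 -> Sigma1'),
    [/\ surface R Sigma0' /\ surface R Sigma1',
        covering_projection p',
        embedding i0 /\ embedding i1,
        countable_dense (~` range i0) /\ countable_dense (~` range i1) &
        p' \o i1 = i0 \o p].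
Proof.
have [[h0 p0 e0] _] := hSigma0; have [[_ _ e1] _] := hSigma1.
have [cp rp ev] := hp.
have [cA0 dA0] := hA0.
pose pt y (nAy : (~` A0) y) : perforated A0 := SigSub (mem_set nAy).
have notin (y : perforated A0) : ~ A0 (set_val y) := @set_valP _ (~` A0) y.
(* Viewed as a map into [Sigma0], [p] can have sheets over open sets that contain punctures. *)
pose q x := set_val (p x).
have cq : continuous q.
  by move=> x; apply: continuous_comp; [exact: cp|exact: set_val_continuous].
have rq : range q = ~` A0.
  apply/seteqP; split=> [_ [x _ <-]|y nAy]; first exact: notin.
  have [x _ px] : range p (pt _ nAy) by rewrite rp.
  by exists x => //; rewrite /q px.
have oq O : open O -> exists2 O', open O' & q @` O = O' `\` A0.
  move=> /(covering_projection_image_open hp)/open_set_typeP[ O' oO' pO].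
  exists O' => //; apply/seteqP; split=> [_ [x Ox <-]|y [ O'y nAy]].
    split; last exact: notin.
    suff : (set_val @^-1` O') (p x) by [].
    by rewrite -pO; exists x.
  have : (set_val @^-1` O') (pt _ nAy) by [].
  by rewrite -pO => -[x Ox px]; exists x => //; rewrite /q px.
have lc := locally_connected_minus_countable e0 cA0.
(* An evenly covered [U] is the trace of an open [U'] of [Sigma0], and its sheets serve as sheets
   over [U']. *)
have sq y : ~ A0 y -> exists U F, sheets q A0 U F /\ U y.
  move=> nAy.
  have [U [ oU Uy] [F [FO tF UF FU]]] := ev (pt _ nAy).
  have /open_set_typeP[U' oU' UE] := oU.
  exists U', F; split; last by move: Uy; rewrite UE.
  split=> //; last by rewrite -UF UE.
  move=> V FV; have hV := FU V FV; have VU := maps_homeomorphically_image hV.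
  split; first exact: FO.
  - by move=> x x' Vx Vx' /set_type_inj; exact: (maps_homeomorphically_inj hV).
  - move=> x Vx; have : (p @` V) (p x) by exists x.
    by rewrite VU UE.
  - move=> z [U'z nAz]; have : U (pt _ nAz) by rewrite UE.
    by rewrite -VU => -[x Vx px]; exists x => //; rewrite /q px.
have csq U F : sheets q A0 U F -> countable F.
  move=> [_ FU tF _]; apply: disjoint_open_countable => //.
    exact: (dense_setC_countable e1 (proj1 hA1)).
  by move=> V /FU[].
have sc0 : @second_countable Sigma0.
  apply: (locally_euclidean_second_countable e0).
  exact: paracompact_separable_lindelof hA0.
pose W := sheeted q A0; have oW : open W := @open_sheeted _ _ q A0.
have inW (y : perforated A0) : set_val y \in W.
  by apply/mem_set; exact/sq/notin.
pose i0 (y : perforated A0) : W := SigSub (inW y).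
have i0E y : set_val (i0 y) = set_val y by [].
have ei0 : embedding i0.
  apply: embedding_of_preimages.
  - exact/continuous_into_set_type/set_val_continuous.
  - by move=> y y' /(congr1 set_val); rewrite !i0E => /set_type_inj.
  - move=> O /open_set_typeP[ O' oO' ->]; exists (set_val @^-1` O') => //.
    exact: open_set_val_preimage.
have ri0 : ~` range i0 = set_val @^-1` A0.
  apply/seteqP; split=> [w nw|w Aw [y _ yw]].
    apply: contrapT => nAw; apply: nw; exists (pt _ nAw) => //.
    exact: set_type_inj.
  by have := notin y; apply; rewrite -i0E yw.
exists W, (extension q A0), (@projection _ _ q A0), i0,
  (to_extension cq rq oq sq).
split.
- split; apply: second_countable_surface.
  + exact: set_type_hausdorff.
  + exact: second_countable_set_type.
  + apply: locally_euclidean_local e0 => w.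
    have [k hk] := open_set_type_partial_homeo w oW.
    by exists setT, W, set_val, k.
  + exact: (extension_hausdorff rq oq lc).
  + exact: (extension_second_countable rq oq lc csq).
  + apply: locally_euclidean_local e0 => z.
    have [U [F [V [hF FV Uz zV]]]] := extensionP z.
    have [s hs] := base_partial_homeo rq oq lc hF FV Uz.
    exists (basic_open U V), U, (@base _ _ q A0), s; split=> //.
    by split=> //; rewrite zV; exact: germ_self.
- exact: (projection_covering rq oq lc).
- by split=> //; exact: to_extension_embedding.
- rewrite ri0 range_to_extension; split.
    exact: countable_dense_open_set_type.
  split; first exact: (base_preimage_countable rq oq lc csq).
  exact: (base_preimage_dense rq oq lc dA0).
(* In [Sigma0] both sides have the value [q x]. *)
- by apply/funext => x; exact: set_type_inj.
Qed.
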